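(* Let $X_1,\dots,X_k$ be bilateral Fréchet sequence spaces in which $(e_n)_{n\in\mathbb{Z}}$ is a basis, and let $B_1,\dots,B_k$ be the backward shifts on $X_1,\dots,X_k$ respectively. Let $\mathcal{F}$ be a family. Then the following assertions are equivalent: (1) $\bigoplus_{i=1}^kB_i$ is $\mathcal{F}$-transitive; (2) $\bigoplus_{i=1}^kB_i$ is $\mathcal{F}$-mixing; (3) $\bigoplus_{i=1}^kB_i$ satisfies the $\mathcal{F}$-Mixing Criterion; (4) for each $\epsilon>0$ and $N\in\mathbb{N}$, $\bigcap_{j=-N}^N\bigcap_{i=1}^k\bigl(C^+_{\epsilon,j}(X_i)\cap C^-_{\epsilon,j}(X_i)\bigr)\in\mathcal{F}$, where for $j\in\mathbb{Z}$ and $i\in\{1,\dots,k\}$, \[ C^+_{\epsilon,j}(X_i)=\{n\in\mathbb{N}_0:\|e_{j+n}\|_{X_i}<\epsilon\},\qquad C^-_{\epsilon,j}(X_i)=\{n\in\mathbb{N}_0:\|e_{j-n}\|_{X_i}<\epsilon\}. \]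
   Context: $\mathbb{N}_0$ is the set of non-negative integers, $\mathbb{K}=\mathbb{R}$ or $\mathbb{C}$. A (Furstenberg) family is a collection $\mathcal{F}$ of subsets of $\mathbb{N}_0$ that is hereditary upward ($A\in\mathcal{F}$, $A\subset B\subset\mathbb{N}_0$ imply $B\in\mathcal{F}$), with the conventions $\mathcal{F}\ne\emptyset$ and $\emptyset\notin\mathcal{F}$. A bilateral Fréchet sequence space is an infinite-dimensional separable Fréchet space $X$ which is a linear subspace of $\mathbb{K}^{\mathbb{Z}}$ with continuous inclusion, where $\mathbb{K}^{\mathbb{Z}}$ has the product topology; $\|\cdot\|_X$ denotes a fixed F-norm defining the topology of $X$ (i.e. $\|x+y\|\le\|x\|+\|y\|$; $\|\lambda x\|\le\|x\|$ for $|\lambda|\le1$; $\|\lambda x\|\to0$ as $\lambda\to0$; $\|x\|=0$ only for $x=0$). $e_n=(\delta_{i,n})_{i\in\mathbb{Z}}$ are the canonical unit sequences; that $(e_n)_{n\in\mathbb{Z}}$ is a basis of $X$ means all $e_n\in X$ and $x=\sum_{n\in\mathbb{Z}}x_ne_n$ in $X$ for each $x=(x_n)_{n\in\mathbb{Z}}\in X$ (convergence of $\sum_{n=-M}^{N}x_ne_n$ as $M,N\to\infty$). The backward shift on $X$ is $B(x_n)_{n}=(x_{n+1})_{n}$, assumed to map $X$ into $X$ (it is then continuous). An operator is a continuous linear self-map of an infinite-dimensional separable Fréchet space. For an operator $T$ on $X$ and $U,V\subset X$, $N_T(U,V)=\{n\in\mathbb{N}_0: T^nU\cap V\ne\emptyset\}$.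 $T$ is $\mathcal{F}$-transitive if $N_T(U,V)\in\mathcal{F}$ for all non-empty open $U,V\subset X$, and $\mathcal{F}$-mixing if $T\oplus T$ is $\mathcal{F}$-transitive. $\mathcal{F}\text{-}\lim_{n\to\infty}z_n=z$ means $\{n\in\mathbb{N}_0:z_n\in U\}\in\mathcal{F}$ for every neighborhood $U$ of $z$. $T$ satisfies the $\mathcal{F}$-Mixing Criterion if there exist dense subsets $X_0,Y_0$ of $X$ and maps $S_n\colon Y_0\to X$ ($n\in\mathbb{N}_0$) such that $\mathcal{F}\text{-}\lim_{n\to\infty}(T^nx_0,S_ny_0,T^nS_ny_0)=(0,0,y_0)$ in $X^3$ for all $x_0\in X_0$, $y_0\in Y_0$. *)

(* Defs.v *)
From HB Require Import structures.
From mathcomp Require Import all_boot all_order all_algebra.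
From mathcomp Require Import complex.
From mathcomp Require Import all_classical all_reals all_analysis.

Set Implicit Arguments.
Unset Strict Implicit.
Unset Printing Implicit Defensive.

Import Order.TTheory GRing.Theory Num.Theory.
Import numFieldNormedType.Exports.

Local Open Scope classical_set_scope.
Local Open Scope ring_scope.

Definition real_or_complex (R : realType) (K : numFieldType) : Prop :=
  K = (R : numFieldType) \/ K = (R[i] : numFieldType).

Definition furstenberg_family (F : set_system nat) : Prop :=
  [/\ F !=set0, ~ F set0 & forall A B, F A -> A `<=` B -> F B].

Section Dynamics.
Context (F : set_system nat).

Definition hitting_times (X : Type) (T : X -> X) (U V : set X) : set nat :=
  [set n | (iter n T @` U) `&` V !=set0].

Definition F_transitive (X : topologicalType) (T : X -> X) : Prop :=
  forall U V : set X, open U -> open V -> U !=set0 -> V !=set0 ->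
    F (hitting_times T U V).

Definition F_mixing (X : topologicalType) (T : X -> X) : Prop :=
  @F_transitive (X * X)%type (fun x => (T x.1, T x.2)).

Definition F_lim (X : topologicalType) (z : nat -> X) (l : X) : Prop :=
  forall U : set X, nbhs l U -> F [set n | U (z n)].

(* The maps S n are only used on Y0; being total is no restriction. *)
Definition F_mixing_criterion (K : numDomainType) (X : preTopologicalLmodType K)
    (T : X -> X) : Prop :=
  exists X0 Y0 : set X, [/\ dense X0, dense Y0 &
    exists S : nat -> X -> X, forall x0 y0, X0 x0 -> Y0 y0 ->
      @F_lim (X * X * X)%type
        (fun n => (iter n T x0, S n y0, iter n T (S n y0))) (0, 0, y0)].

End Dynamics.

Section Frechet.
Context (R : realType) (K : numFieldType).

Record F_norm (X : lmodType K) (p : X -> R) : Prop := {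
  F_normD : forall x y, p (x + y) <= p x + p y ;
  F_normZ : forall (a : K) x, `|a| <= 1 -> p (a *: x) <= p x ;
  F_normZ_cvg0 : forall x, p (a *: x) @[a --> (0 : K^o)] --> (0 : R) ;
  F_norm_eq0 : forall x, p x = 0 -> x = 0 }.

Definition defines_topology (X : preTopologicalLmodType K) (p : X -> R) : Prop :=
  forall (x : X) (U : set X),
    nbhs x U <-> exists2 e : R, 0 < e & [set y | p (y - x) < e] `<=` U.

(* Completeness for the translation-invariant uniformity; the uniform structure
   carried by a [tvsType] is only required to induce the topology. *)
Definition linear_cauchy (X : preTopologicalLmodType K) (G : set_system X) : Prop :=
  forall U : set X, nbhs 0 U ->
    exists2 A, G A & forall x y, A x -> A y -> U (x - y).

Definition linearly_complete (X : preTopologicalLmodType K) : Prop :=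
  forall G : set_system X, ProperFilter G -> linear_cauchy G ->
    exists l : X, G --> l.

(* Local convexity is part of [tvsType]. *)
Definition frechet (X : tvsType K) : Prop :=
  (exists p : X -> R, F_norm p /\ defines_topology p) /\ linearly_complete X.

Definition separable_space (X : topologicalType) : Prop :=
  exists2 D : set X, countable D & dense D.

Definition infinite_dimensional (X : lmodType K) : Prop :=
  ~ exists n (v : 'I_n -> X), forall x, exists c : 'I_n -> K,
      x = \sum_(i < n) c i *: v i.

(* The inclusion of X into K^Z is the injective linear map [embed]. *)
Record bilateral_frechet_space := {
  bilateral_tvs :> tvsType K ;
  embed : {linear bilateral_tvs -> (int -> K^o)} ;
  fnorm : bilateral_tvs -> R ;
  bilateral_frechet : frechet bilateral_tvs ;
  bilateral_separable : separable_space bilateral_tvs ;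
  bilateral_infinite_dimensional : infinite_dimensional bilateral_tvs ;
  embed_inj : injective embed ;
  embed_continuous :
    continuous (embed : bilateral_tvs -> {ptws int -> K^o}) ;
  fnormP : F_norm fnorm ;
  fnorm_topology : defines_topology fnorm }.

Definition unit_sequences (X : bilateral_frechet_space) (e : int -> X) : Prop :=
  forall n i : int, embed X (e n) i = (i == n)%:R.

(* The sum of x_n e_n over -M <= n <= N, reindexed by n = m - M. *)
Definition bilateral_sum (X : bilateral_frechet_space) (e : int -> X) (x : X)
    (M N : nat) : X :=
  \sum_(0 <= m < (M + N).+1) embed X x (m%:Z - M%:Z) *: e (m%:Z - M%:Z).

Definition bilateral_basis (X : bilateral_frechet_space) (e : int -> X) : Prop :=
  unit_sequences e /\
  forall x : X,
    (fun MN : nat * nat => bilateral_sum e x MN.1 MN.2)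
      @ filter_prod \oo \oo --> x.

(* A map B with this property is linear, and continuous by the closed graph
   theorem. *)
Definition backward_shift (X : bilateral_frechet_space) (B : X -> X) : Prop :=
  forall (x : X) (n : int), embed X (B x) n = embed X x (n + 1).

Definition C_plus (X : bilateral_frechet_space) (e : int -> X) (eps : R)
  (j : int) : set nat := [set n | fnorm (e (j + n%:Z)) < eps].

Definition C_minus (X : bilateral_frechet_space) (e : int -> X) (eps : R)
  (j : int) : set nat := [set n | fnorm (e (j - n%:Z)) < eps].

End Frechet.

(* Finite direct sum: the product of the spaces with the product topology. *)
Definition direct_sum (I : finType) (K : numFieldType) (E : I -> tvsType K) :
  Type := prod_topology (fun i => E i).

Section DirectSum.
Context (I : finType) (K : numFieldType) (E : I -> tvsType K).
Local Notation S := (direct_sum E).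

HB.instance Definition _ := Topological.copy S (prod_topology (fun i => E i)).

Let add (x y : S) : S := fun i => x i + y i.
Let opp (x : S) : S := fun i => - x i.
Let zero : S := fun i => 0.
Let scale (a : K) (x : S) : S := fun i => a *: x i.

Let addA : associative add.
Proof. by move=> x y z; apply: functional_extensionality_dep => i; exact: addrA. Qed.
Let addC : commutative add.
Proof. by move=> x y; apply: functional_extensionality_dep => i; exact: addrC. Qed.
Let add0 : left_id zero add.
Proof. by move=> x; apply: functional_extensionality_dep => i; exact: add0r. Qed.
Let addN : left_inverse zero opp add.
Proof. by move=> x; apply: functional_extensionality_dep => i; exact: addNr. Qed.

HB.instance Definition _ := GRing.isZmodule.Build S addA addC add0 addN.

Let scaleA a b (x : S) : scale a (scale b x) = scale (a * b) x.
Proof. by apply: functional_extensionality_dep => i; exact: scalerA. Qed.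
Let scale1 : left_id 1 scale.
Proof. by move=> x; apply: functional_extensionality_dep => i; exact: scale1r. Qed.
Let scaleDr : right_distributive scale +%R.
Proof. by move=> a x y; apply: functional_extensionality_dep => i; exact: scalerDr. Qed.
Let scaleDl (x : S) : {morph scale^~ x : a b / a + b}.
Proof. by move=> a b; apply: functional_extensionality_dep => i; exact: scalerDl. Qed.

HB.instance Definition _ :=
  GRing.Zmodule_isLmodule.Build K S scaleA scale1 scaleDr scaleDl.

Definition direct_sum_map (T : forall i, E i -> E i) (x : S) : S :=
  fun i => T i (x i).

End DirectSum.

(* Main.v *)
(** The norm conditions in the last assertion say that a certain filter on
    [nat], the one along which all [e_(j + n)] and [e_(j - n)] tend to [0], is
    contained in [F].  Finitely supported vectors witness the Mixing Criterion
    along this filter, and transitivity along a filter, unlike along a general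
    family, passes to [T + T]; both then hold for the larger family [F].
    Conversely, the maps [x |-> x_n e_n] are equicontinuous; so if [x] is close
    to [2 (e_(-N) + ... + e_N)] and [B^n x] is close to
    [4 (e_(-N) + ... + e_N)], then [n > 2 N], the coordinates of [x] at [j + n]
    and of [B^n x] at [j - n] have modulus at least [1] for [|j| <= N], and the
    corresponding terms, hence [e_(j + n)] and [e_(j - n)], are small. *)

Require Import Defs.
From HB Require Import structures.
From mathcomp Require Import all_boot all_order all_algebra.
From mathcomp Require Import complex.
From mathcomp Require Import all_classical all_reals all_analysis.
From mathcomp Require Import lra ring zify.

Set Implicit Arguments.
Unset Strict Implicit.
Unset Printing Implicit Defensive.

Import Order.TTheory GRing.Theory Num.Theory.
Import numFieldNormedType.Exports.

Local Open Scope classical_set_scope.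
Local Open Scope ring_scope.

(** * Elementary properties of F-norms *)

Section FNorm.
Context (R : realType) (K : numFieldType).

Section Algebra.
Context (X : lmodType K) (p : X -> R) (Fp : F_norm p).

(** The map [a |-> p (a *: 0)] is constant, so its limit at [0] is both [p 0] and [0]. *)
Lemma F_norm0 : p 0 = 0.
Proof.
have := F_normZ_cvg0 Fp (0 : X).
rewrite (_ : (fun a : K^o => p (a *: 0)) = cst (p 0)); last first.
  by apply/funext => a; rewrite scaler0.
move=> /cvg_lim <- //; apply/esym; exact: lim_cst.
Qed.

Lemma F_normN x : p (- x) = p x.
Proof.
apply/le_anti/andP; split; last rewrite -{1}(opprK x).
  by rewrite -(scaleN1r x) (F_normZ Fp)// normrN1.
by rewrite -(scaleN1r (- x)) (F_normZ Fp)// normrN1.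
Qed.

Lemma F_norm_distC x y : p (x - y) = p (y - x).
Proof. by rewrite -F_normN opprB. Qed.

Lemma F_norm_le_scale (a : K) x : 1 <= `|a| -> p x <= p (a *: x).
Proof.
move=> a1; have a0 : a != 0 by rewrite -normr_gt0 (lt_le_trans _ a1).
rewrite -{1}(scale1r x) -(mulVf a0) -scalerA (F_normZ Fp)// normfV invf_le1//.
by rewrite normr_gt0.
Qed.

End Algebra.

Lemma F_norm_nbhs (X : preTopologicalLmodType K) (p : X -> R) (x : X) (r : R) :
  defines_topology p -> 0 < r -> \forall y \near x, p (y - x) < r.
Proof. by move=> dp r0; apply/dp; exists r. Qed.

(** * Completeness and equicontinuity of pointwise null sequences *)

Section Equicontinuity.
Context (X : preTopologicalLmodType K) (p : X -> R).
Hypotheses (Fp : F_norm p) (dp : defines_topology p) (cX : linearly_complete X).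

(** The first hypothesis telescopes: each later closed ball lies in every earlier one. As the radii
    become arbitrarily small, the centres form a Cauchy sequence, and its limit lies in all the
    balls. *)
Lemma nested_balls (s : nat -> X) (r : nat -> R) :
  (forall n, p (s n.+1 - s n) + r n.+1 <= r n) -> (forall n, 0 < r n) ->
  (forall eps, 0 < eps -> exists n, r n < eps) ->
  exists l, forall n, p (l - s n) <= r n.
Proof.
move=> sr r_gt0 r_small.
have nest n m : (n <= m)%N -> p (s m - s n) + r m <= r n.
  elim: m => [|m IH]; first by rewrite leqn0 => /eqP->; rewrite subrr F_norm0// add0r.
  rewrite leq_eqVlt => /predU1P[->|]; first by rewrite subrr F_norm0// add0r.
  rewrite ltnS => /IH {}IH.
  have := F_normD Fp (s m.+1 - s m) (s m - s n); rewrite addrA subrK.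
  have := sr m; lra.
have [|l sl] := cX (G := s @ \oo) _.
  move=> U /dp[eps eps0 epsU].
  have [n rn] := r_small (eps / 2) ltac:(lra).
  exists [set x | p (x - s n) <= r n].
    by exists n => // m /= nm; have := nest _ _ nm; have := r_gt0 m; lra.
  move=> x y /= xn yn; apply: epsU => /=; rewrite subr0.
  have := F_normD Fp (x - s n) (s n - y); rewrite addrA subrK.
  rewrite (F_norm_distC Fp (s n)); lra.
exists l => n; apply/ler_addgt0Pl => eps eps0.
have [N _ /(_ (maxn n N))/= sN] := sl _ (F_norm_nbhs l dp eps0).
have := nest n (maxn n N) (leq_maxl _ _); have := r_gt0 (maxn n N).
have := F_normD Fp (l - s (maxn n N)) (s (maxn n N) - s n); rewrite addrA subrK.
have := sN (leq_maxr _ _); rewrite (F_norm_distC Fp _ l); lra.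
Qed.

(* Uniform boundedness by a gliding hump: if it fails, nested balls can be chosen
   so that on the m-th one some [T n] with [n >= m] stays away from [0], and their
   common point contradicts the pointwise convergence. *)
Lemma F_norm_equicontinuous (T : nat -> X -> X) :
  (forall n, {morph T n : x y / x + y}) ->
  (forall n, T n x @[x --> 0] --> 0) ->
  (forall x, T n x @[n --> \oo] --> 0) ->
  forall eps, 0 < eps -> exists2 d, 0 < d &
    forall n x, p x < d -> p (T n x) < eps.
Proof.
move=> Tadd Tcont T0 eps eps0; apply: contrapT => noequi.
have {}Tcont n e : 0 < e -> exists2 d, 0 < d & forall x, p x < d -> p (T n x) < e.
  move=> e0; have /dp[d d0 dT] := Tcont n _ (F_norm_nbhs 0 dp e0).
  by exists d => // x xd; have := dT x; rewrite /= !subr0; exact.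
have {}T0 x e : 0 < e -> exists M, forall n, (M <= n)%N -> p (T n x) < e.
  move=> e0; have [M _ MT] := T0 x _ (F_norm_nbhs 0 dp e0).
  by exists M => n /MT /=; rewrite subr0.
have Tfin M e : 0 < e -> exists2 d, 0 < d &
    forall n x, (n < M)%N -> p x < d -> p (T n x) < e.
  move=> e0; elim: M => [|M [d d0 dT]]; first by exists 1.
  have [d' d'0 d'T] := Tcont M e e0.
  exists (Num.min d d'); first by rewrite lt_min d0.
  move=> n x; rewrite ltnS leq_eqVlt lt_min => /predU1P[->|nM] /andP[xd xd'].
    exact: d'T.
  exact: dT.
(* A state consists of a centre, a radius and an index bound. The premise [0 < a.1.2] gives every
   state a successor, as dependent choice demands; positivity of the radii along the chosen sequence
   is then an induction. *)
pose good (a b : X * R * nat) := 0 < a.1.2 ->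
  [/\ 0 < b.1.2, b.1.2 <= b.2%:R^-1, (a.2 < b.2)%N,
   p (b.1.1 - a.1.1) + b.1.2 <= a.1.2 &
   exists2 n, (a.2 <= n)%N &
     forall x, p (x - b.1.1) <= b.1.2 -> eps / 2 <= p (T n x)].
have step a : exists b, good a b.
  case: a => -[s r] M; rewrite /good /=.
  have [r0|r0] := ltP 0 r; last by exists (s, r, M).
  have [M1 TM1] := T0 s (eps / 4) ltac:(lra).
  pose M' := maxn M M1.
  (* Below [d] the maps with index less than [M'] stay under [eps], so an index [n] witnessing the
     failure of equicontinuity at such a point is at least [M']. *)
  have [d d0 dT] := Tfin M' eps eps0.
  have [x [xd [n nx]]] : exists x, p x < Num.min d (r / 2) /\ exists n, eps <= p (T n x).
    apply: contrapT => nox; apply: noequi; exists (Num.min d (r / 2)).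
      by rewrite lt_min d0; lra.
    move=> n x xd; rewrite ltNge; apply/negP => nx; apply: nox.
    by exists x; split => //; exists n.
  move: xd; rewrite lt_min => /andP[xd xr].
  have nM' : (M' <= n)%N.
    by rewrite leqNgt; apply/negP => /dT/(_ xd); rewrite ltNge nx.
  have [d' d'0 d'T] := Tcont n (eps / 4) ltac:(lra).
  have M0 : 0 < M.+1%:R^-1 :> R by rewrite invr_gt0.
  (* The bound [d' / 2] keeps [T n (s + x - y)] below [eps / 4] on the new ball, [r / 2] together
     with [p x < r / 2] gives nesting, and the inverse of [M.+1] makes the radii vanish. *)
  exists (s + x, Num.min (d' / 2) (Num.min (r / 2) M.+1%:R^-1), M.+1) => _ /=.
  split=> //.
  - by rewrite !lt_min M0 andbT; apply/andP; split; lra.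
  - by rewrite !ge_min lexx !orbT.
  - rewrite [s + x]addrC addrK.
    have : Num.min (d' / 2) (Num.min (r / 2) M.+1%:R^-1) <= r / 2.
      by rewrite !ge_min lexx !orbT.
    lra.
  - exists n; first exact: leq_trans (leq_maxl _ _) nM'.
    move=> y; rewrite le_min => /andP[yd' _].
    have := d'T (s + x - y); rewrite (F_norm_distC Fp) => /(_ ltac:(lra)) yT.
    have sT := TM1 n (leq_trans (leq_maxr _ _) nM').
    (* Two of the three terms are below [eps / 4] while [p (T n x)] is at least [eps], which leaves
       [eps / 2] for [T n y]. *)
    have Tx : T n x = T n (s + x - y) + T n y - T n s.
      by rewrite -Tadd subrK Tadd [T n s + _]addrC addrK.
    have := F_normD Fp (T n (s + x - y) + T n y) (- T n s); rewrite -Tx F_normN//.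
    have := F_normD Fp (T n (s + x - y)) (T n y); lra.
have [f [f0 fS]] := dependent_choice (fun a => cid (step a)) (0, 1, 0%N).
have f_gt0 n : 0 < (f n).1.2.
  by elim: n => [|n IH]; [rewrite f0 /=; lra | case: (fS n IH)].
have fM n : (n <= (f n).2)%N.
  by elim: n => [//|n IH]; have [_ _ + _ _] := fS n (f_gt0 n); exact: leq_ltn_trans.
have [|||l fl] := @nested_balls (fun n => (f n).1.1) (fun n => (f n).1.2).
- by move=> n; have [] := fS n (f_gt0 n).
- exact: f_gt0.
- move=> e e0; have [n _ /(_ _ (leqnn n)) /= ne] := near_infty_natSinv_lt (PosNum e0).
  exists n.+1; have [_ + _ _ _] := fS n (f_gt0 n) => /le_lt_trans; apply.
  apply: le_lt_trans ne; rewrite lef_pV2 ?posrE ?ltr0n// ?ler_nat//.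
  exact: leq_trans (fM n.+1).
have [M TM] := T0 l (eps / 2) ltac:(lra).
have [_ _ _ _ [n nM]] := fS M (f_gt0 M).
move=> /(_ l (fl M.+1)); rewrite leNgt TM//.
exact: leq_trans (fM M) nM.
Qed.

End Equicontinuity.
End FNorm.

(** * Coordinatewise convergence in a finite direct sum *)

Section DirectSumTopology.
Context (I : finType) (K : numFieldType) (E : I -> tvsType K).

Lemma direct_sum_proj_continuous i : continuous (fun x : direct_sum E => x i).
Proof. exact: proj_continuous. Qed.

Lemma direct_sum_cvg (T : Type) (G : set_system T) {FG : Filter G}
    (f : T -> direct_sum E) (l : direct_sum E) :
  (forall i, f t i @[t --> G] --> l i) -> f @ G --> l.
Proof.
move=> fl; apply/cvg_sup => i U [V] [[W] oW <-] Wl WU.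
by apply: filterS WU _; apply: (fl i); exact: open_nbhs_nbhs.
Qed.

Lemma direct_sum_add_continuous :
  continuous (fun x : direct_sum E * direct_sum E => x.1 + x.2).
Proof.
move=> x; apply: direct_sum_cvg => i.
have cvg1 : y.1 i @[y --> x] --> x.1 i.
  apply: (@cvg_comp _ _ _ fst (fun z : direct_sum E => z i)); first exact: cvg_fst.
  exact: direct_sum_proj_continuous.
have cvg2 : y.2 i @[y --> x] --> x.2 i.
  apply: (@cvg_comp _ _ _ snd (fun z : direct_sum E => z i)); first exact: cvg_snd.
  exact: direct_sum_proj_continuous.
apply: (@cvg_comp _ _ _ (fun y => (y.1 i, y.2 i)) (fun z : E i * E i => z.1 + z.2)).
  exact: cvg_pair cvg1 cvg2.
exact: (@add_continuous (E i) (x.1 i, x.2 i)).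
Qed.

Lemma iter_direct_sum_map (T : forall i, E i -> E i) n (x : direct_sum E) i :
  iter n (direct_sum_map T) x i = iter n (T i) (x i).
Proof. by elim: n => //= n <-. Qed.

End DirectSumTopology.

(** * Transitivity, mixing and the Mixing Criterion along a family *)

Section Dynamics.
Context (F : set_system nat).
Hypothesis Fup : forall A B, F A -> A `<=` B -> F B.

Lemma F_transitive_nbhs (X : topologicalType) (T : X -> X) (u v : X)
    (U V : set X) :
  F_transitive F T -> nbhs u U -> nbhs v V -> F (hitting_times T U V).
Proof.
move=> FT; rewrite !nbhsE => -[U' [oU' U'u] UU'] [V' [oV' V'v] VV'].
apply: Fup (FT U' V' oU' oV' _ _) _; [by exists u|by exists v|].
by move=> n [y [[x /UU' Ux <-] /VV' Vx]]; exists (iter n T x); split => //; exists x.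
Qed.

Lemma iter_pair (X : Type) (T : X -> X) n (x : X * X) :
  iter n (fun x => (T x.1, T x.2)) x = (iter n T x.1, iter n T x.2).
Proof. by elim: n => [|n /= ->]; first case: x. Qed.

Lemma F_mixing_transitive (X : topologicalType) (T : X -> X) :
  F_mixing F T -> F_transitive F T.
Proof.
move=> FT U V oU oV [u Uu] [v Vv].
have UU : nbhs (u, u) (U `*` U).
  by exists (U, U) => //; split; exact: open_nbhs_nbhs.
have VV : nbhs (v, v) (V `*` V).
  by exists (V, V) => //; split; exact: open_nbhs_nbhs.
apply: Fup (F_transitive_nbhs FT UU VV) _ => n [_ [[x [Ux _] <-]]].
rewrite iter_pair => -[Vx _].
by exists (iter n T x.1); split => //; exists x.1.
Qed.

(** Open sets of the square contain boxes, and a time that is a hitting time for both factors is one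
    for the boxes; stability under intersection puts these times in [F]. *)
Lemma filter_transitive_mixing (X : topologicalType) (T : X -> X) :
  Filter F -> F_transitive F T -> F_mixing F T.
Proof.
move=> FF FT U V oU oV [u Uu] [v Vv].
have [[U1 U2] [/= U1u U2u] UU] := open_nbhs_nbhs (conj oU Uu).
have [[V1 V2] [/= V1v V2v] VV] := open_nbhs_nbhs (conj oV Vv).
have h1 := F_transitive_nbhs FT U1u V1v.
have h2 := F_transitive_nbhs FT U2u V2v.
apply: Fup (filterI h1 h2) _.
move=> n [[_ [[x1 Ux1 <-] Vx1]] [_ [[x2 Ux2 <-] Vx2]]].
exists (iter n T x1, iter n T x2); split; last by apply: VV.
by exists (x1, x2); [exact: UU|exact: iter_pair].
Qed.

(** The point [x0 + S n y0] is close to [x0], and its image under the n-th iterate, the sum of the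
    images of [x0] and [S n y0], is close to [0 + y0]. *)
Lemma F_mixing_criterion_transitive (K : numDomainType)
    (X : preTopologicalLmodType K) (T : X -> X) :
  continuous (fun x : X * X => x.1 + x.2) -> {morph T : x y / x + y} ->
  F_mixing_criterion F T -> F_transitive F T.
Proof.
move=> addc Tadd [X0 [Y0 [dX0 dY0 [S cS]]]] U V oU oV U0 V0.
have [x0 [Ux0 X0x0]] := dX0 U U0 oU.
have [y0 [Vy0 Y0y0]] := dY0 V V0 oV.
have Tn n : {morph iter n T : x y / x + y}.
  elim: n => [//|n IH] x y; rewrite !iterS.
  by rewrite (IH x y) Tadd.
have nU : \forall b \near (0 : X), U (x0 + b).
  have := addc (x0, 0) U; rewrite /= addr0 => /(_ (open_nbhs_nbhs (conj oU Ux0))).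
  case=> -[/= P Q] [Px Q0] PQ; apply: filterS Q0 => b Qb.
  by apply: (PQ (x0, b)); split => //; exact: nbhs_singleton.
have nV : \forall z \near ((0, y0) : X * X), V (z.1 + z.2).
  by apply: (addc (0, y0) V); rewrite /= add0r; exact: open_nbhs_nbhs.
case: nV => -[/= P Q] [P0 Qy0] PQ.
(* All three conditions are imposed through one neighbourhood of [(0, 0, y0)], since [F] need not be
   stable under intersection. *)
apply: Fup (cS x0 y0 X0x0 Y0y0
  [set z | [/\ P z.1.1, U (x0 + z.1.2) & Q z.2]] _) _.
  exists (P `*` [set b | U (x0 + b)], Q) => /=.
    by split => //; exists (P, [set b | U (x0 + b)]).
  by move=> [[a b] c] /= [[]].
move=> n /= [Px Ux Qx]; exists (iter n T (x0 + S n y0)); split.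
  by exists (x0 + S n y0).
by rewrite Tn; exact: (PQ (iter n T x0, iter n T (S n y0))).
Qed.

End Dynamics.

Lemma F_transitive_sub (F G : set_system nat) (X : topologicalType) (T : X -> X) :
  G `<=` F -> F_transitive G T -> F_transitive F T.
Proof. by move=> GF GT U V oU oV U0 V0; apply/GF/GT. Qed.

Lemma F_mixing_criterion_sub (F G : set_system nat) (K : numDomainType)
    (X : preTopologicalLmodType K) (T : X -> X) :
  G `<=` F -> F_mixing_criterion G T -> F_mixing_criterion F T.
Proof.
move=> GF [X0 [Y0 [dX0 dY0 [S cS]]]]; exists X0, Y0; split => //.
by exists S => x0 y0 X0x0 Y0y0 U /(cS x0 y0 X0x0 Y0y0)/GF.
Qed.

(** * Scalar multiples tending to zero *)

Section ScaleCvg.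
Context (K : numFieldType) (X : tvsType K).

Lemma scale_cvg0l (T : Type) (G : set_system T) {FG : Filter G} (a : T -> K^o) (v : X) :
  a t @[t --> G] --> (0 : K^o) -> a t *: v @[t --> G] --> (0 : X).
Proof.
move=> a0; rewrite -(scale0r v).
apply: (@cvg_comp _ _ _ (fun t => (a t, v)) (fun z : K^o * X => z.1 *: z.2)).
  exact: cvg_pair a0 (cvg_cst v).
exact: (@scale_continuous _ X (0, v)).
Qed.

Lemma scale_cvg0r (T : Type) (G : set_system T) {FG : Filter G} (a : K) (f : T -> X) :
  f t @[t --> G] --> (0 : X) -> a *: f t @[t --> G] --> (0 : X).
Proof.
move=> f0; rewrite -(scaler0 _ a).
apply: (@cvg_comp _ _ _ (fun t => (a : K^o, f t)) (fun z : K^o * X => z.1 *: z.2)).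
  exact: cvg_pair (cvg_cst (a : K^o)) f0.
exact: (@scale_continuous _ X (a, 0)).
Qed.

End ScaleCvg.

(** * Finite sums and basis expansions in one sequence space *)

Section Shift.
Context (R : realType) (K : numFieldType) (X : bilateral_frechet_space R K).
Context (e : int -> X).

(** With the translation [z] as a parameter, both the iterates of the backward shift and their right
    inverses act on finitely supported vectors by changing [z]. *)
Definition shifted_sum (N : nat) (c : int -> K) (z : int) : X :=
  \sum_(0 <= m < (N + N).+1) c (m%:Z - N%:Z) *: e (m%:Z - N%:Z + z).

Lemma embedZ a x j : embed X (a *: x) j = a * (embed X x j : K).
Proof. by have -> : embed X (a *: x) = a *: embed X x by exact: linearZ. Qed.

Lemma embedD x y j : embed X (x + y) j = (embed X x j : K) + embed X y j.
Proof. by have -> : embed X (x + y) = embed X x + embed X y by exact: raddfD. Qed.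

Lemma bilateral_sum_shifted x N :
  bilateral_sum e x N N = shifted_sum N (embed X x) 0.
Proof. by apply: eq_bigr => m _; rewrite addr0. Qed.

Lemma embed_shifted_sum N c z j : unit_sequences e ->
  embed X (shifted_sum N c z) j =
  if - N%:Z <= j - z <= N%:Z then c (j - z) else 0.
Proof.
move=> ue; rewrite /shifted_sum linear_sum fct_sumE.
transitivity (\sum_(0 <= m < (N + N).+1)
    if m%:Z - N%:Z + z == j then c (m%:Z - N%:Z) else 0).
  by apply: eq_bigr => m _; rewrite embedZ ue mulr_natr mulrb eq_sym.
case: ifPn => [jN|jN]; last first.
  rewrite big_nat big1// => m mN; case: eqP => // mj; lia.
(* The only summand that can contribute to coordinate [j] has index [j - z + N]. *)
have [m0 m0E] : exists m0 : nat, m0%:Z = j - z + N%:Z.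
  by exists (absz (j - z + N%:Z)); lia.
rewrite -big_mkcond (eq_bigl (fun m => m == m0)); last by move=> m /=; lia.
rewrite big_nat1_eq m0E addrK ifT//; lia.
Qed.

Lemma embed_coord_continuous j : continuous (fun x : X => embed X x j : K^o).
Proof.
move=> x; apply: (@continuous_comp _ {ptws int -> K^o} _ (embed X) (proj j)).
  exact: embed_continuous.
exact: proj_continuous.
Qed.

Context (B : X -> X) (hB : backward_shift B).

Lemma embed_iter_shift n x j : embed X (iter n B x) j = embed X x (j + n%:Z).
Proof.
elim: n j => [|n IH] j; first by rewrite addr0.
by rewrite /= hB IH intS addrA.
Qed.

Lemma backward_shiftD : {morph B : x y / x + y}.
Proof.
move=> x y; apply: embed_inj; apply/funext => j.
by rewrite embedD !hB embedD.
Qed.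

Hypothesis he : bilateral_basis e.

Lemma iter_shifted_sum n N c z :
  iter n B (shifted_sum N c z) = shifted_sum N c (z - n%:Z).
Proof.
apply: embed_inj; apply/funext => j; rewrite embed_iter_shift.
by rewrite !embed_shifted_sum; [rewrite opprB addrA|case: he..].
Qed.

Lemma bilateral_sumSr x M N :
  bilateral_sum e x M N.+1 = bilateral_sum e x M N + embed X x N.+1 *: e N.+1.
Proof.
rewrite /bilateral_sum addnS big_nat_recr//=; congr (_ + _).
by rewrite (_ : _ - _ = N.+1%:Z)//; lia.
Qed.

Lemma bilateral_sumSl x M N :
  bilateral_sum e x M.+1 N =
  embed X x (- M.+1%:Z) *: e (- M.+1%:Z) + bilateral_sum e x M N.
Proof.
rewrite /bilateral_sum addSn big_nat_recl//=; congr (_ + _); first by rewrite sub0r.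
apply: eq_bigr => m _.
by rewrite (_ : m.+1%:Z - M.+1%:Z = m%:Z - M%:Z)//; lia.
Qed.

Lemma bilateral_sum_cvg x (M N : nat -> nat) :
  M n @[n --> \oo] --> \oo -> N n @[n --> \oo] --> \oo ->
  bilateral_sum e x (M n) (N n) @[n --> \oo] --> x.
Proof.
have [_ /(_ x) ex] := he => cM cN.
apply: (@cvg_comp _ _ _ (fun n => (M n, N n)) (fun MN => bilateral_sum e x MN.1 MN.2) _ _ _ _ ex).
exact: (cvg_pair cM cN).
Qed.

Lemma bilateral_sum_diff_cvg0 x (M N M' N' : nat -> nat) :
  M n @[n --> \oo] --> \oo -> N n @[n --> \oo] --> \oo ->
  M' n @[n --> \oo] --> \oo -> N' n @[n --> \oo] --> \oo ->
  bilateral_sum e x (M n) (N n) - bilateral_sum e x (M' n) (N' n)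
    @[n --> \oo] --> (0 : X).
Proof.
move=> cM cN cM' cN'; rewrite -(subrr x).
apply: (@cvg_comp _ _ _ (fun n => (bilateral_sum e x (M n) (N n),
    bilateral_sum e x (M' n) (N' n))) (fun z : X * X => z.1 - z.2)).
  exact: (cvg_pair (bilateral_sum_cvg (x := x) cM cN) (bilateral_sum_cvg (x := x) cM' cN')).
exact: (@sub_continuous X (x, x)).
Qed.

(** Each term is the difference of two partial sums that differ at one end, and both converge to
    [x]. The sign [s] selects the end: negative indices for [true], positive ones for [false]. *)
Lemma bilateral_term_cvg0 (s : bool) x :
  embed X x ((-1) ^+ s * n.+1%:Z) *: e ((-1) ^+ s * n.+1%:Z) @[n --> \oo] --> (0 : X).
Proof.
have cS : n.+1 @[n --> \oo] --> \oo by exact: (cvg_addnl 1).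
case: s; rewrite ?expr1 ?expr0.
- have := bilateral_sum_diff_cvg0 x cS cvg_id cvg_id cvg_id.
  apply: cvg_trans; apply: near_eq_cvg; near=> n.
  by rewrite bilateral_sumSl addrK mulN1r.
- have := bilateral_sum_diff_cvg0 x cvg_id cS cvg_id cvg_id.
  apply: cvg_trans; apply: near_eq_cvg; near=> n.
  by rewrite bilateral_sumSr [_ + _ *: _]addrC addrK mul1r.
Unshelve. all: by end_near. Qed.

(** The maps [x |-> x_j e_j] are split into the sequences over [j > 0] and over [j < 0]. Each
    consists of continuous additive maps tending pointwise to [0], so the uniform boundedness
    argument applies; the index [0] belongs to neither. *)
Lemma bilateral_terms_equicontinuous (eps : R) : 0 < eps -> exists2 d, 0 < d &
  forall (x : X) j, j != 0 -> fnorm x < d -> fnorm (embed X x j *: e j) < eps.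
Proof.
move=> eps0; have [_ cX] := bilateral_frechet X.
pose t (s : bool) (n : nat) (x : X) :=
  embed X x ((-1) ^+ s * n.+1%:Z) *: e ((-1) ^+ s * n.+1%:Z).
have tequi s : exists2 d, 0 < d &
    forall n x, fnorm x < d -> fnorm (t s n x) < eps.
  apply: (F_norm_equicontinuous (@fnormP R K X) (@fnorm_topology R K X) cX) => //.
  - by move=> n x y; rewrite /t embedD scalerDl.
  - move=> n; apply: scale_cvg0l.
    have := @embed_coord_continuous ((-1) ^+ s * n.+1%:Z) 0.
    by rewrite /continuous_at raddf0.
  - exact: bilateral_term_cvg0.
have [[d1 d10 d1t] [d2 d20 d2t]] := (tequi true, tequi false).
exists (Num.min d1 d2); first by rewrite lt_min d10.
move=> x [[//|j]|j] _; rewrite lt_min => /andP[xd1 xd2].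
  by have := d2t j x xd2; rewrite /t expr0 mul1r.
by have := d1t j x xd1; rewrite /t expr1 mulN1r NegzE.
Qed.

End Shift.

(** * The direct sum of the shifts and the filter of small unit vectors *)

Section DirectSumShift.
Context (R : realType) (K : numFieldType) (k : nat).
Context (X : 'I_k -> bilateral_frechet_space R K) (e : forall i, int -> X i).
Hypothesis he : forall i, bilateral_basis (@e i).
Context (B : forall i, X i -> X i).
Hypothesis hB : forall i, backward_shift (@B i).

Local Notation S := (direct_sum X).

Definition small_units (eps : R) (N : nat) : set nat :=
  \bigcap_(j in [set j : int | - N%:Z <= j <= N%:Z])
    \bigcap_(i in [set: 'I_k]) (C_plus (@e i) eps j `&` C_minus (@e i) eps j).

(** The sets [small_units eps N] shrink as [eps] decreases and [N] grows, hence form a filter base.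
    The filter need not be proper. *)
Definition small_units_filter : set_system nat :=
  filter_from [set q : R * nat | 0 < q.1 /\ (0 < q.2)%N]
    (fun q => small_units q.1 q.2).

Global Instance small_units_filter_filter : Filter small_units_filter.
Proof.
apply: filter_from_filter; first by exists (1, 1%N).
move=> [a M] [b N] [/= a0 M0] [/= b0 N0].
exists (Num.min a b, maxn M N).
  by split => /=; [rewrite lt_min a0|rewrite leq_max M0].
move=> n nE; split => j /= jM i _.
  have [|+ +] := nE j _ i I; first by rewrite /=; lia.
  by rewrite /C_plus /C_minus /= !lt_min => /andP[? _] /andP[].
have [|+ +] := nE j _ i I; first by rewrite /=; lia.
by rewrite /C_plus /C_minus /= !lt_min => /andP[_ ?] /andP[].
Qed.

Lemma unit_cvg0 (s : bool) i j :
  e i (j + (-1) ^+ s * n%:Z) @[n --> small_units_filter] --> (0 : X i).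
Proof.
move=> U /(fnorm_topology (b := X i))[eps eps0 epsU].
(* This window contains [j], and the successor makes its size positive. *)
exists (eps, (absz j).+1) => //= n /(_ j) /= nj; apply: epsU; rewrite /= subr0.
have [|] := nj _ i I; first by lia.
by case: s; rewrite ?expr1 ?expr0 ?mulN1r ?mul1r.
Qed.

(** A single support bound [d.1] serves all the coordinate spaces, while the coefficients [d.2]
    depend on the space. *)
Definition finite_vector (d : nat * ('I_k -> int -> K)) (z : int) : S :=
  fun i => shifted_sum (@e i) d.1 (d.2 i) z.

Lemma finite_vector_cvg0 (s : bool) d :
  finite_vector d ((-1) ^+ s * n%:Z) @[n --> small_units_filter] --> (0 : S).
Proof.
apply: direct_sum_cvg => i; rewrite /finite_vector /shifted_sum.
rewrite (_ : (0 : S) i = \sum_(0 <= m < (d.1 + d.1).+1) (0 : X i)); last first.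
  by rewrite big1.
apply: cvg_big => [|m _]; first exact: add_continuous.
by apply: scale_cvg0r; exact: unit_cvg0.
Qed.

Lemma embed_finite_vector d z i j :
  embed (X i) (finite_vector d z i) j =
  if - d.1%:Z <= j - z <= d.1%:Z then d.2 i (j - z) else 0.
Proof. by apply: embed_shifted_sum; case: (he i). Qed.

(** By the basis property, the symmetric truncations of a vector converge to it in every coordinate
    space. *)
Lemma finite_vector_dense : dense (range (finite_vector^~ 0)).
Proof.
move=> O [x Ox] oO.
pose v N := finite_vector (N, fun i => embed (X i) (x i)) 0.
have vx : v N @[N --> \oo] --> x.
  apply: direct_sum_cvg => i; rewrite /v /finite_vector /=.
  under eq_cvg do rewrite -bilateral_sum_shifted.
  exact: (bilateral_sum_cvg (he i)).
have : \forall N \near \oo, O (v N) by apply: vx; exact: open_nbhs_nbhs.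
by move=> /filter_ex[N ON]; exists (v N); split => //; eexists.
Qed.

Lemma iter_finite_vector n d z :
  iter n (direct_sum_map B) (finite_vector d z) = finite_vector d (z - n%:Z).
Proof.
apply/functional_extensionality_dep => i.
by rewrite iter_direct_sum_map (iter_shifted_sum (@hB i) (@he i)).
Qed.

(** Both dense sets consist of the finitely supported vectors, and [S n] translates by [n] to the
    right, so that the n-th iterate undoes [S n] exactly. *)
Lemma shift_small_units_criterion :
  F_mixing_criterion small_units_filter (direct_sum_map B).
Proof.
exists (range (finite_vector^~ 0)), (range (finite_vector^~ 0)).
split; [exact: finite_vector_dense|exact: finite_vector_dense|].
(* [S n] must depend on the vector alone, so one representation is chosen for each; the default
   value only concerns vectors without one. *)
pose coeffs (y : S) := xget (0%N, fun _ _ => 0) [set d | finite_vector d 0 = y].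
exists (fun n y => finite_vector (coeffs y) n%:Z) => x y [d _ <-] [d' _ d'y].
have yE : finite_vector (coeffs y) 0 = y by rewrite /coeffs; case: xgetP => // /(_ d').
have c1 : iter n (direct_sum_map B) (finite_vector d 0)
    @[n --> small_units_filter] --> (0 : S).
  have := @finite_vector_cvg0 true d.
  by under eq_cvg do rewrite expr1 mulN1r -(sub0r _%:Z) -iter_finite_vector.
have c2 : finite_vector (coeffs y) n%:Z @[n --> small_units_filter] --> (0 : S).
  have := @finite_vector_cvg0 false (coeffs y).
  by under eq_cvg do rewrite expr0 mul1r.
have c3 : iter n (direct_sum_map B) (finite_vector (coeffs y) n%:Z)
    @[n --> small_units_filter] --> y.
  under eq_cvg do rewrite iter_finite_vector subrr yE.
  exact: cvg_cst.
exact: cvg_pair (cvg_pair c1 c2) c3.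
Qed.

Lemma direct_sum_shiftD : {morph direct_sum_map B : x y / x + y}.
Proof.
by move=> x y; apply/functional_extensionality_dep => i; exact: backward_shiftD.
Qed.

(** Coordinate functionals are continuous, and only finitely many spaces and indices are
    involved. *)
Lemma near_finite_vector (a : K) (N : nat) (d : 'I_k -> R) :
  (forall i, 0 < d i) ->
  \forall x \near finite_vector (N, fun _ _ => a) 0, forall i,
    fnorm (x i - finite_vector (N, fun _ _ => a) 0 i) < d i /\
    forall j : int, - N%:Z <= j <= N%:Z -> `|embed (X i) (x i) j - a| < 1.
Proof.
move=> d0; set u := finite_vector _ _.
have Fu : Filter (nbhs u) := nbhs_filter u.
have near_proj i (P : set (X i)) : nbhs (u i) P -> \forall x \near u, P (x i).
  exact: (@direct_sum_proj_continuous _ _ _ i u).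
suff near_i i : \forall x \near u, fnorm (x i - u i) < d i /\
    forall j : int, - N%:Z <= j <= N%:Z -> `|embed (X i) (x i) j - a| < 1.
  exact: (filter_forall _ near_i).
have near_d : \forall x \near u, fnorm (x i - u i) < d i.
  apply: (near_proj i (fun y => fnorm (y - u i) < d i)).
  exact: F_norm_nbhs (fnorm_topology (b := X i)) (d0 i).
have nj (m : 'I_(N + N).+1) :
    \forall x \near u, `|embed (X i) (x i) (m%:Z - N%:Z) - a| < 1.
  have ua : embed (X i) (u i) (m%:Z - N%:Z) = a.
    by rewrite embed_finite_vector /= ifT//; have := ltn_ord m; lia.
  apply: (near_proj i (fun y => `|embed (X i) y (m%:Z - N%:Z) - a| < 1)).
  have /cvgr_dist_lt/(_ 1 ltr01) := @embed_coord_continuous _ _ (X i) (m%:Z - N%:Z) (u i).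
  by rewrite ua; apply: filterS => y; rewrite distrC.
apply: filterS (filterI near_d (filter_forall _ nj)) => x [xd xm].
split=> // j jN.
have jm : (absz (j + N%:Z)%R < (N + N).+1)%N by lia.
by have := xm (Ordinal jm); rewrite (_ : _ - _ = j) //=; lia.
Qed.

Lemma F_transitive_small_units (F : set_system nat) :
  (forall A B, F A -> A `<=` B -> F B) -> F_transitive F (direct_sum_map B) ->
  forall eps N, 0 < eps -> F (small_units eps N).
Proof.
move=> Fup FT eps N eps0.
have /choice[d dP] (i : 'I_k) : exists d, 0 < d /\
    forall (x : X i) j, j != 0 -> fnorm x < d -> fnorm (embed (X i) x j *: e i j) < eps.
  by have [d d0 dP] := bilateral_terms_equicontinuous (@he i) eps0; exists d.
(* Outside the window, [x] and its difference from the finite vector have the same coordinate.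
   Equicontinuity applied to the difference makes [x_j e_j] small, and [e_j] has no larger norm
   because [x_j] has modulus at least [1]. *)
have unit_small (a : K) i (x : X i) j :
    fnorm (x - finite_vector (N, fun _ _ => a) 0 i) < d i ->
    ~~ (- N%:Z <= j <= N%:Z) -> 1 <= `|embed (X i) x j| -> fnorm (e i j) < eps.
  move=> xd jN x1; have j0 : j != 0 by apply: contraNneq jN => ->; lia.
  apply: le_lt_trans (proj2 (dP i) _ _ j0 xd).
  rewrite embedD -scaleN1r embedZ embed_finite_vector /= subr0.
  by rewrite (negbTE jN) mulr0 addr0; exact: (F_norm_le_scale (@fnormP _ _ (X i))).
have ge1 (a y : K) : 2 <= `|a| -> `|y - a| < 1 -> 1 <= `|y|.
  move=> a2; rewrite distrC => ya.
  have := ler_normD (a - y) y; rewrite subrK => /(le_trans a2) a2'.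
  have : 2 <= 1 + `|y| by apply: le_trans a2' _; rewrite lerD2r ltW.
  by rewrite (_ : 2 = 1 + 1) // lerD2l.
have nU := @near_finite_vector 2 N d (fun i => proj1 (dP i)).
have nV := @near_finite_vector 4 N d (fun i => proj1 (dP i)).
apply: Fup (F_transitive_nbhs Fup FT nU nV) _ => n [_ [[x xU <-] xV]] j /= jN i _.
have [xd x2] := xU i; have [] := xV i.
rewrite iter_direct_sum_map => yd y4.
(* Otherwise [n - N] lies in the window, and the coordinate of [x] there, which is coordinate [-N]
   of its n-th iterate, would be within [1] of both [2] and [4]. *)
have Nn : (N + N < n)%N.
  rewrite ltnNge; apply/negP => nN.
  have := x2 (- N%:Z + n%:Z) ltac:(lia); have := y4 (- N%:Z) ltac:(lia).
  rewrite (embed_iter_shift (@hB i)) => h4 h2; have := ltrD h4 h2.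
  rewrite distrC; set y := embed _ _ _ => h.
  have := le_lt_trans (ler_normD (4 - y) (y - 2)) h.
  by rewrite addrA subrK (_ : 4 - 2 = 2%:R) ?normr_nat ?ltxx//; ring.
split; rewrite /C_plus /C_minus /=.
  (* Coordinate [j + n] of [x] is coordinate [j] of the iterate, hence close to [4], and
     [j + n > N]. *)
  apply: (unit_small 2 i (x i)) => //; first by lia.
  rewrite -(embed_iter_shift (@hB i)); apply: (ge1 4); last exact: y4.
  by rewrite normr_nat ler_nat.
(* Symmetrically, coordinate [j - n] of the iterate is coordinate [j] of [x], hence close to [2],
   and [j - n < -N]. *)
apply: (unit_small 4 i _ _ yd); first by lia.
rewrite (embed_iter_shift (@hB i)) subrK; apply: (ge1 2); last exact: x2.
by rewrite normr_nat.
Qed.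

End DirectSumShift.

(** * Equivalence of the four assertions *)

Theorem theorem5p3 (R : realType) (K : numFieldType)
    (hK : real_or_complex R K)
    (k : nat) (hk : (0 < k)%N)
    (X : 'I_k -> bilateral_frechet_space R K)
    (e : forall i, int -> X i)
    (he : forall i, bilateral_basis (e i))
    (B : forall i, X i -> X i)
    (hB : forall i, backward_shift (B i))
    (F : set_system nat) (hF : furstenberg_family F) :
  [<-> F_transitive F (direct_sum_map B);
       F_mixing F (direct_sum_map B);
       F_mixing_criterion F (direct_sum_map B);
       forall (eps : R) (N : nat), 0 < eps -> (0 < N)%N ->
         F (\bigcap_(j in [set j : int | - N%:Z <= j <= N%:Z])
              \bigcap_(i in [set: 'I_k])
                (C_plus (e i) eps j `&` C_minus (e i) eps j))].
Proof.
have [_ _ Fup] := hF.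
have mix_trans := F_mixing_transitive Fup (T := direct_sum_map B).
have crit_trans := F_mixing_criterion_transitive Fup
  (@direct_sum_add_continuous _ _ _) (direct_sum_shiftD hB).
have trans_units := F_transitive_small_units he hB Fup.
have units_F : (forall eps N, 0 < eps -> (0 < N)%N -> F (small_units e eps N)) ->
    small_units_filter e `<=` F.
  by move=> Fe A [[eps N] [/= eps0 N0]]; apply: Fup; exact: Fe.
have crit := shift_small_units_criterion he hB.
(* Transitivity, mixing and the criterion hold unconditionally along the filter of small units; only
   its inclusion in [F] remains at stake. *)
have trans : F_transitive (small_units_filter e) (direct_sum_map B).
  apply: F_mixing_criterion_transitive crit; last exact: direct_sum_shiftD.
    by move=> A C AS /filterS; apply.
  exact: direct_sum_add_continuous.
have mix : F_mixing (small_units_filter e) (direct_sum_map B).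
  apply: filter_transitive_mixing trans => A C AS /filterS; exact.
tfae.
(* The first two implications pass through the norm condition, which places the filter inside
   [F]. *)
- move=> FT; apply: F_transitive_sub mix.
  by apply: units_F => eps N eps0 _; exact: trans_units.
- move=> /mix_trans FT; apply: F_mixing_criterion_sub crit.
  by apply: units_F => eps N eps0 _; exact: trans_units.
- by move=> /crit_trans FT eps N eps0 _; exact: trans_units.
- by move=> /units_F GF; exact: F_transitive_sub trans.
Qed.
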